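(* Let $\mathcal{A}$ be the set of all Arndt compositions (of all weights $n\ge0$), and for $\sigma\in\mathcal{A}$ let $\mathrm{last}(\sigma)$ be its last part (with $\mathrm{last}=0$ for the empty composition). Then $$\sum_{\sigma\in\mathcal{A}}x^{|\sigma|}y^{\mathrm{last}(\sigma)}=\frac{1 - x - x^2 - x^2 y + 2 x^3 y + 2 x^4 y - x^5 y - x^4 y^2}{ (1 - x - x^2) (1 - x y) (1 - x^2 y)}.$$
   Context: A composition of $n\ge0$ is a finite sequence $\sigma=(\sigma_1,\dots,\sigma_\ell)$ of positive integers summing to $n=|\sigma|$ (the empty composition is the composition of $0$). An Arndt composition is one with $\sigma_{2i-1}>\sigma_{2i}$ for every positive integer $i$ with $2i\le\ell$. *)

(* Defs.v *)
From HB Require Import structures.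
From mathcomp Require Import all_boot all_order all_algebra.
From mathcomp Require Import boolp classical_sets cardinality fsbigop.

Set Implicit Arguments.
Unset Strict Implicit.
Unset Printing Implicit Defensive.

Import GRing.Theory.
Local Open Scope ring_scope.

(* R[[t]]: formal power series in one variable. The record wrapper keeps this
   ring apart from the pointwise structures on the function type nat -> R. *)
Record fps (R : Type) := FPS { fcoef : nat -> R }.

Lemma fpsP (R : Type) (a b : fps R) : fcoef a =1 fcoef b -> a = b.
Proof. by case: a b => [a] [b] /= /funext ->. Qed.

HB.instance Definition _ (R : Type) := gen_eqMixin (fps R).
HB.instance Definition _ (R : Type) := gen_choiceMixin (fps R).

Section FpsZmodule.
Variable R : zmodType.
Implicit Types a b c : fps R.

Definition fps_zero : fps R := FPS (fun=> 0).
Definition fps_opp a : fps R := FPS (fun n => - fcoef a n).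
Definition fps_add a b : fps R := FPS (fun n => fcoef a n + fcoef b n).

Lemma fps_addA : associative fps_add.
Proof. by move=> a b c; apply: fpsP => n /=; rewrite addrA. Qed.

Lemma fps_addC : commutative fps_add.
Proof. by move=> a b; apply: fpsP => n /=; rewrite addrC. Qed.

Lemma fps_add0 : left_id fps_zero fps_add.
Proof. by move=> a; apply: fpsP => n /=; rewrite add0r. Qed.

Lemma fps_addN : left_inverse fps_zero fps_opp fps_add.
Proof. by move=> a; apply: fpsP => n /=; rewrite addNr. Qed.

HB.instance Definition _ :=
  GRing.isZmodule.Build (fps R) fps_addA fps_addC fps_add0 fps_addN.

End FpsZmodule.

Section FpsRing.
Variable R : comNzRingType.
Implicit Types a b c : fps R.

Definition fps_one : fps R := FPS (fun n => (n == 0%N)%:R).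
Definition fps_mul a b : fps R :=
  FPS (fun n => \sum_(i < n.+1) fcoef a i * fcoef b (n - i)).

Definition fps_trunc m a : {poly R} := \poly_(i < m) fcoef a i.

Lemma fps_mul_trunc m n a b : (n < m)%N ->
  fcoef (fps_mul a b) n = (fps_trunc m a * fps_trunc m b)`_n.
Proof.
move=> ltnm; rewrite coefM /=; apply: eq_bigr => i _.
by rewrite !coef_poly (leq_ltn_trans _ ltnm) ?leq_ord // (leq_ltn_trans _ ltnm) ?leq_subr.
Qed.

Lemma fps_mulA : associative fps_mul.
Proof.
move=> a b c; apply: fpsP => n.
have truncM (u v : fps R) (i : nat) : (i < n.+1)%N ->
    (fps_trunc n.+1 (fps_mul u v))`_i = (fps_trunc n.+1 u * fps_trunc n.+1 v)`_i.
  by move=> lti; rewrite coef_poly lti (@fps_mul_trunc n.+1).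
rewrite !(@fps_mul_trunc n.+1) //.
transitivity (fps_trunc n.+1 a * (fps_trunc n.+1 b * fps_trunc n.+1 c))`_n.
  rewrite coefM [RHS]coefM; apply: eq_bigr => i _.
  by rewrite truncM // ltnS leq_subr.
rewrite mulrA coefM [RHS]coefM; apply: eq_bigr => i _.
by rewrite truncM.
Qed.

Lemma fps_mulC : commutative fps_mul.
Proof.
by move=> a b; apply: fpsP => n; rewrite !(@fps_mul_trunc n.+1) // mulrC.
Qed.

Lemma fps_mul1 : left_id fps_one fps_mul.
Proof.
move=> a; apply: fpsP => n /=; rewrite big_ord_recl /= subn0 mul1r.
by rewrite big1 ?addr0 // => i _; rewrite mul0r.
Qed.

Lemma fps_mulDl : left_distributive fps_mul (@fps_add R).
Proof.
move=> a b c; apply: fpsP => n /=; rewrite -big_split /=.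
by apply: eq_bigr => i _; rewrite mulrDl.
Qed.

Lemma fps_one_neq0 : fps_one != 0.
Proof.
apply/eqP => /(congr1 (fun a : fps R => fcoef a 0)) /= /eqP.
by rewrite oner_eq0.
Qed.

HB.instance Definition _ :=
  GRing.Zmodule_isComNzRing.Build (fps R)
    fps_mulA fps_mulC fps_mul1 fps_mulDl fps_one_neq0.

Definition fps_const (c : R) : fps R := FPS (fun n => if n == 0%N then c else 0).
Definition fps_var : fps R := FPS (fun n => (n == 1%N)%:R).

End FpsRing.

Section FpsUnitRing.
Variable R : comUnitRingType.
Implicit Types a b : fps R.

Definition fps_unit : {pred fps R} :=
  fun a => fcoef a 0 \is a GRing.unit.

(* The first n coefficients of a^-1, obtained by solving a * a^-1 = 1. *)
Fixpoint fps_inv_seq a (n : nat) : seq R :=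
  if n is m.+1 then
    let s := fps_inv_seq a m in
    rcons s ((fcoef a 0)^-1 *
             ((m == 0%N)%:R - \sum_(i < m) fcoef a (m - i) * s`_i))
  else [::].

Definition fps_inv a : fps R :=
  if a \in fps_unit then FPS (fun n => (fps_inv_seq a n.+1)`_n) else a.

Lemma size_fps_inv_seq a n : size (fps_inv_seq a n) = n.
Proof. by elim: n => //= n IHn; rewrite size_rcons IHn. Qed.

Lemma nth_fps_inv_seq a n i : (i < n)%N ->
  (fps_inv_seq a n)`_i = (fps_inv_seq a i.+1)`_i.
Proof.
elim: n => // n IHn; rewrite ltnS leq_eqVlt => /predU1P[-> //|ltin].
by rewrite [fps_inv_seq a n.+1]/= nth_rcons size_fps_inv_seq ltin IHn.
Qed.

Lemma fps_mulV : {in fps_unit, left_inverse 1 fps_inv *%R}.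
Proof.
move=> a ua; rewrite mulrC; apply: fpsP => n.
rewrite /fps_inv ua /GRing.mul /= (reindex_inj rev_ord_inj) /=.
rewrite big_ord_recr /= subnn subn0.
have -> : \sum_(i < n) fcoef a (n.+1 - i.+1) *
    nth 0 (rcons (fps_inv_seq a (n - (n.+1 - i.+1)))
      ((fcoef a 0)^-1 * (((n - (n.+1 - i.+1))%N == 0%N)%:R -
        \sum_(j < n - (n.+1 - i.+1))
          fcoef a (n - (n.+1 - i.+1) - j) *
          (fps_inv_seq a (n - (n.+1 - i.+1)))`_j))) (n - (n.+1 - i.+1))
  = \sum_(i < n) fcoef a (n - i) * (fps_inv_seq a n)`_i.
  apply: eq_bigr => i _; rewrite subSS subKn; last exact: ltnW.
  by congr (_ * _); rewrite [RHS]nth_fps_inv_seq.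
rewrite nth_rcons size_fps_inv_seq ltnn eqxx mulrA divrr // mul1r.
by rewrite addrC subrK.
Qed.

Lemma fps_unitPl a b : b * a = 1 -> fps_unit a.
Proof.
move=> /(congr1 (fun c => fcoef c 0)).
rewrite /GRing.mul /= big_ord_recl big_ord0 addr0 => ba1.
by apply/unitrPr; exists (fcoef b 0); rewrite mulrC.
Qed.

Lemma fps_inv_out : {in [predC fps_unit], fps_inv =1 id}.
Proof. by move=> a; rewrite inE /= /fps_inv => /negPf->. Qed.

HB.instance Definition _ :=
  GRing.ComNzRing_hasMulInverse.Build (fps R) fps_mulV fps_unitPl fps_inv_out.

End FpsUnitRing.

(* Z[[x, y]] is taken as Z[[y]][[x]]: the coefficient of x^n y^k in F is
   fcoef (fcoef F n) k. *)
Definition fps2 := fps (fps int).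
HB.instance Definition _ := GRing.ComUnitRing.on fps2.

Definition fcoef2 (F : fps2) (n k : nat) : int := fcoef (fcoef F n) k.
Definition fpsX : fps2 := fps_var (fps int).
Definition fpsY : fps2 := fps_const (fps_var int).

Local Open Scope classical_set_scope.

(* Infinite sums in Z[[x, y]] are coefficientwise: a family is summable when
   each coefficient is nonzero for only finitely many of its members. *)
Definition fps2_summable (T : choiceType) (A : set T) (f : T -> fps2) : Prop :=
  forall n k, finite_set [set t | A t /\ fcoef2 (f t) n k != 0].

Definition fps2_sum (T : choiceType) (A : set T) (f : T -> fps2) : fps2 :=
  FPS (fun n => FPS (fun k => \sum_(t \in A) fcoef2 (f t) n k)).

Definition is_composition (s : seq nat) : bool := all (fun p => 0 < p)%N s.

(* s_j, with parts indexed from 1 *)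
Definition part (s : seq nat) (j : nat) : nat := nth 0%N s j.-1.

Definition is_arndt (s : seq nat) : Prop :=
  is_composition s /\
  forall i : nat, (0 < i)%N -> (2 * i <= size s)%N ->
    (part s (2 * i - 1) > part s (2 * i))%N.

Definition weight (s : seq nat) : nat := sumn s.
Definition last_part (s : seq nat) : nat := last 0%N s.

Definition arndt_compositions : set (seq nat) := [set s | is_arndt s].

(* Main.v *)
(** An Arndt composition of even length is a concatenation of pairs
    (b + d, b) with b, d >= 1, and one of odd length is an even one followed by
    an arbitrary part.  A pair has generating function
    P(y) = x/(1-x) * x^2y/(1-x^2y), so the even-length compositions, counted by
    weight alone, have generating function e = 1 + e P(1), that is
    e (1-x-x^2) = (1-x)(1-x^2).  Recording the last part only in the last block
    gives the total 1 + e P(y) + e xy/(1-xy).  All sums converge x-adically over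
    the coefficient ring Z[[y]], which justifies sums over disjoint unions and
    products. *)

Require Import Defs.
From mathcomp Require Import all_boot all_order all_algebra.
From mathcomp Require Import finmap boolp classical_sets cardinality fsbigop.
From mathcomp Require Import ring zify.

Set Implicit Arguments.
Unset Strict Implicit.
Unset Printing Implicit Defensive.

Import GRing.Theory.
Local Open Scope ring_scope.
Local Open Scope classical_set_scope.

(** * Infinite sums of power series *)

Section FpsSum.
Variable R : comNzRingType.
Implicit Types (c : fps R) (T U : choiceType).

Definition fps_summable {T} (A : set T) (f : T -> fps R) : Prop :=
  forall n, finite_set [set t | A t /\ fcoef (f t) n != 0].

Definition fps_sum {T} (A : set T) (f : T -> fps R) : fps R :=
  FPS (fun n => \sum_(t \in A) fcoef (f t) n).

Lemma fcoefM (a b : fps R) n :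
  fcoef (a * b) n = \sum_(i < n.+1) fcoef a i * fcoef b (n - i).
Proof. by []. Qed.

Lemma fcoefX_lt c n m : fcoef c 0 = 0 -> (m < n)%N -> fcoef (c ^+ n) m = 0.
Proof.
move=> c0; elim: n m => // n IHn m ltmn; rewrite exprS fcoefM big1 // => -[i /= lti] _.
by case: i lti => [|i] lti; rewrite ?c0 ?mul0r // IHn ?mulr0 //; lia.
Qed.

(** The Cauchy product at degree [n] involves all coefficients of degree at most [n], so one finite
    index set must serve all of them at once; outside it the series vanish up to degree [n]. *)
Definition low_support {T} (A : set T) (f : T -> fps R) (n : nat) : set T :=
  [set t | A t /\ exists2 i, (i <= n)%N & fcoef (f t) i != 0].

Lemma finite_low_support {T} {A : set T} {f : T -> fps R} n :
  fps_summable A f -> finite_set (low_support A f n).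
Proof.
move=> fA; pose F i := [set t | A t /\ fcoef (f t) i != 0].
apply: (@sub_finite_set _ _ (\bigcup_(i in `I_n.+1) F i)); last first.
  by apply: bigcup_finite => // i _; apply: fA.
by move=> t [At [i lein nz]]; exists i.
Qed.

Lemma low_support0 {T} (A : set T) (f : T -> fps R) n t i :
  A t -> ~ low_support A f n t -> (i <= n)%N -> fcoef (f t) i = 0.
Proof.
by move=> At nSt lein; apply/eqP/negPn/negP => nz; apply: nSt; split=> //; exists i.
Qed.

Lemma fcoef_fps_sum {T} (A : set T) (f : T -> fps R) n i :
  fps_summable A f -> (i <= n)%N ->
  fcoef (fps_sum A f) i = \sum_(t <- fset_set (low_support A f n)) fcoef (f t) i.
Proof.
move=> fA lein; rewrite -fsbig_finite; last exact: finite_low_support.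
apply/esym/fsbig_widen => [t []//|t [At nSt]] /=.
exact: low_support0 nSt lein.
Qed.

Lemma fps_sum_set1 {T} (t : T) (f : T -> fps R) : fps_sum [set t] f = f t.
Proof. by apply: fpsP => n /=; rewrite fsbig_set1. Qed.

Lemma eq_fps_sum {T} {A : set T} {f g : T -> fps R} :
  (forall t, A t -> f t = g t) -> fps_sum A f = fps_sum A g.
Proof.
by move=> fg; apply: fpsP => n /=; apply: eq_fsbigr => t; rewrite inE => /fg ->.
Qed.

Lemma fps_sum_image {T U} (h : T -> U) (A : set T) (f : U -> fps R) :
  {in A &, injective h} -> fps_sum (h @` A) f = fps_sum A (f \o h).
Proof. by move=> hinj; apply: fpsP => n /=; rewrite fsbig_image. Qed.

Lemma fps_sumU {T} (A B : set T) (f : T -> fps R) :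
  fps_summable (A `|` B) f -> A `&` B `<=` set0 ->
  fps_sum (A `|` B) f = fps_sum A f + fps_sum B f.
Proof.
move=> fAB AB0; apply: fpsP => n /=.
(* [fsbigU0] needs finite index sets, whereas [A] and [B] may be infinite; hence the restriction to
   indices with nonzero coefficient. *)
have supp C : \sum_(t \in C) fcoef (f t) n
            = \sum_(t \in C `&` [set t | fcoef (f t) n != 0]) fcoef (f t) n.
  by apply/esym/fsbig_widen => [t []//|t [Ct /not_andP[]//= /negP/negPn/eqP]].
rewrite supp setIUl fsbigU0 -?supp //.
- by apply: sub_finite_set (fAB n) => t [At nz]; split=> //; left.
- by apply: sub_finite_set (fAB n) => t [Bt nz]; split=> //; right.
- by move=> t [[At _] [Bt _]]; apply: AB0.
Qed.

Lemma fps_sumZ {T} (A : set T) c (f : T -> fps R) :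
  fps_summable A f -> fps_sum A (fun t => c * f t) = c * fps_sum A f.
Proof.
move=> fA; apply: fpsP => n.
rewrite fcoefM; under eq_bigr => i _.
  by rewrite (@fcoef_fps_sum _ _ _ n) ?leq_subr // mulr_sumr; over.
rewrite exchange_big /= -[RHS]fsbig_finite; last exact: finite_low_support.
apply/esym/fsbig_widen => [t []//|t [At nSt]] /=.
rewrite big1 // => i _.
by rewrite (low_support0 At nSt) ?mulr0 ?leq_subr.
Qed.

Lemma fcoefM_low_support {T U} (A : set T) (B : set U) (f : T -> fps R)
    (g : U -> fps R) n t u : A t -> B u ->
  fcoef (f t * g u) n != 0 -> (low_support A f n `*` low_support B g n) (t, u).
Proof.
move=> At Bu nz; apply: contrapT => /not_andP nS; case/eqP: nz.
rewrite fcoefM big1 // => i _; case: nS => /= nS.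
  by rewrite (low_support0 At nS) ?mul0r ?leq_ord.
by rewrite (low_support0 Bu nS) ?mulr0 ?leq_subr.
Qed.

Lemma fps_summableM {T U} (A : set T) (B : set U) (f : T -> fps R)
    (g : U -> fps R) : fps_summable A f -> fps_summable B g ->
  fps_summable (A `*` B) (fun p => f p.1 * g p.2).
Proof.
move=> fA gB n.
apply: (@sub_finite_set _ _ (low_support A f n `*` low_support B g n)).
  by case=> t u [[At Bu] nz]; apply: fcoefM_low_support.
by apply: finite_setX; apply: finite_low_support.
Qed.

(** At degree [n] both factors reduce to finite sums over their low supports. Distributivity gives a
    sum over the rectangle of these supports, and pairs outside it contribute nothing. *)
Lemma fps_sumM {T U} (A : set T) (B : set U) (f : T -> fps R)
    (g : U -> fps R) : fps_summable A f -> fps_summable B g ->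
  fps_sum (A `*` B) (fun p => f p.1 * g p.2) = fps_sum A f * fps_sum B g.
Proof.
move=> fA gB; apply: fpsP => n; rewrite fcoefM.
under [RHS]eq_bigr => i _.
  rewrite (@fcoef_fps_sum _ A _ n) ?leq_ord // (@fcoef_fps_sum _ B _ n) ?leq_subr //.
  rewrite big_distrlr /=; over.
have finA := finite_low_support n fA; have finB := finite_low_support n gB.
rewrite exchange_big /=; under [RHS]eq_bigr do rewrite exchange_big /=.
rewrite -[RHS]fsbig_finite //; under [RHS]eq_fsbigr do rewrite -fsbig_finite //.
rewrite [RHS]pair_fsbig //=.
apply/esym/fsbig_widen => [[t u] [[/= At _] [Bu _]]//|[t u] [[/= At Bu] nS]] /=.
by apply/eqP/negPn/negP => nz; apply: nS; apply: fcoefM_low_support.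
Qed.

Lemma fps_summable_geom c : fcoef c 0 = 0 ->
  fps_summable [set: nat] (fun n => c ^+ n.+1).
Proof.
move=> c0 n; apply: (@sub_finite_set _ _ `I_n) => // m [_ /=].
by apply: contraNltn => lenm; rewrite fcoefX_lt // ltnS.
Qed.

(** Splitting off the first term gives [g = c + c * g]. The exponents start at 1 because they will
    count parts and differences that are positive. *)
Lemma fps_sum_geom c : fcoef c 0 = 0 ->
  (1 - c) * fps_sum [set: nat] (fun n => c ^+ n.+1) = c.
Proof.
move=> c0; have sc := @fps_summable_geom c c0.
set g := fps_sum _ _; suff gE : g = c + c * g by rewrite mulrBl mul1r {1}gE addrK.
have defT : [set: nat] = [set 0%N] `|` succn @` [set: nat].
  by apply/seteqP; split=> // -[|n] _; [left|right; exists n].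
rewrite {1}/g defT fps_sumU; first last.
- by move=> n [-> []].
- by rewrite -defT.
rewrite fps_sum_set1 expr1 fps_sum_image; last by move=> m n _ _ [].
by rewrite -fps_sumZ //; congr (_ + _); apply: eq_fps_sum => n _; rewrite -exprS.
Qed.

End FpsSum.

(** * From x-adic sums to sums by coefficients of x and y *)

Lemma fcoef_sum (R : zmodType) (I : Type) (r : seq I) (F : I -> fps R) k :
  fcoef (\sum_(i <- r) F i) k = \sum_(i <- r) fcoef (F i) k.
Proof. by elim/big_rec2: _ => // i y1 y2 _ <-. Qed.

(** Here [fps_summable] is taken over Z[[y]]: for each [n], only finitely many members have a
    nonzero series in y as coefficient of x^n. This bounds every [k] at once. *)
Lemma fps2_summableW (T : choiceType) (A : set T) (f : T -> fps2) :
  fps_summable A f -> fps2_summable A f.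
Proof.
move=> fA n k; apply: sub_finite_set (fA n) => t [At nz]; split=> //.
by apply: contraNneq nz => fn0; rewrite /fcoef2 fn0.
Qed.

Lemma fps2_sumE (T : choiceType) (A : set T) (f : T -> fps2) :
  fps_summable A f -> fps2_sum A f = fps_sum A f.
Proof.
move=> fA; apply: fpsP => n; apply: fpsP => k.
rewrite [fcoef (fps_sum A f) n](fcoef_fps_sum fA (leqnn n)) fcoef_sum -fsbig_finite; last exact: finite_low_support.
apply/esym/fsbig_widen => [t []//|t [At nSt]] /=.
by rewrite /fcoef2 (low_support0 At nSt).
Qed.

(** * Decomposition of Arndt compositions into blocks *)

Definition even_arndt : set (seq nat) :=
  [set s | is_arndt s /\ ~~ odd (size s)].

(** The new part has odd position, so it opens a pair that is not yet closed and meets no descent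
    condition. *)
Lemma is_arndt_rcons s a : ~~ odd (size s) ->
  is_arndt (rcons s a) <-> is_arndt s /\ (0 < a)%N.
Proof.
move=> ev; rewrite /is_arndt /is_composition all_rcons size_rcons /part.
split=> [[/andP[a0 ps] des]|[[ps des] a0]]; split=> //.
- split=> // i i0 le; have := des i i0 (leqW le).
  by rewrite !nth_rcons !ifT //; lia.
- by rewrite a0.
- move=> i i0 le; have le' : (2 * i <= size s)%N by lia.
  by rewrite !nth_rcons !ifT; [exact: des|lia|lia].
Qed.

Lemma is_arndt_rcons2 s a b : ~~ odd (size s) ->
  is_arndt (rcons (rcons s a) b) <-> is_arndt s /\ (0 < b < a)%N.
Proof.
move=> ev; rewrite /is_arndt /is_composition !all_rcons !size_rcons /part.
split=> [[/and3P[b0 a0 ps] des]|[[ps des] /andP[b0 ltba]]]; split=> //.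
- split=> // i i0 le; have := des i i0 (leqW (leqW le)).
  by rewrite !nth_rcons !size_rcons !ifT //; lia.
(* This index selects the last pair, whose zero-based positions are [size s] and [(size s).+1]. *)
- rewrite b0 /=; have := des (size s)./2.+1 isT.
  have -> : (2 * (size s)./2.+1 - 1).-1 = size s by lia.
  have -> : (2 * (size s)./2.+1).-1 = (size s).+1 by lia.
  rewrite !nth_rcons !size_rcons !ltnn !eqxx ltnS leqnn; apply; lia.
- by rewrite b0 ps (ltn_trans b0 ltba).
- move=> i i0; rewrite leq_eqVlt => /predU1P[eqi|lti].
    have -> : (2 * i - 1).-1 = size s by lia.
    have -> : (2 * i).-1 = (size s).+1 by lia.
    by rewrite !nth_rcons !size_rcons !ltnn !eqxx ltnS leqnn.
  have le' : (2 * i <= size s)%N by lia.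
  by rewrite !nth_rcons !size_rcons !ifT; [exact: des|lia..].
Qed.

Definition rcons_part (p : seq nat * nat) : seq nat := rcons p.1 p.2.+1.

(* The pair (d, b) encodes the parts b + d + 2 > b + 1. *)
Definition rcons_pair (p : seq nat * (nat * nat)) : seq nat :=
  rcons (rcons p.1 (p.2.1.+1 + p.2.2.+1)%N) p.2.2.+1.

Lemma rcons_part_inj : injective rcons_part.
Proof. by move=> [s a] [t b] /rcons_inj[-> ->]. Qed.

Lemma rcons_pair_inj : injective rcons_pair.
Proof.
move=> [s [d b]] [t [d' b']] /rcons_inj[/rcons_inj[-> /= eqd] eqb].
by move: eqd; rewrite eqb => /addIn[->].
Qed.

Definition arndt_step : set (seq nat) := rcons_pair @` (even_arndt `*` (setT `*` setT)).

Lemma even_arndtE : even_arndt = [set [::]] `|` arndt_step.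
Proof.
apply/seteqP; split=> [s [ars evs]|s [->|[[t [d b]] [[art evt] _] <-]]]; last 2 first.
- by split=> //; split=> // -[].
- split; last by rewrite !size_rcons /= negbK.
  by apply/is_arndt_rcons2 => //; split=> //; lia.
case/lastP: s ars evs => [|s b]; first by left.
case/lastP: s => [|s a]; first by [].
rewrite !size_rcons /= negbK => + evs; case/is_arndt_rcons2 => // ars ltba.
(* Inverse of the encoding in [rcons_pair]; no subtraction truncates since [0 < b < a]. *)
right; exists (s, ((a - b).-1, b.-1)) => //.
by rewrite /rcons_pair /=; congr (rcons (rcons _ _) _); lia.
Qed.

Lemma arndtE :
  arndt_compositions = even_arndt `|` rcons_part @` (even_arndt `*` setT).
Proof.
apply/seteqP; split=> [s ars|s [[]//|[[t a] [[art evt] _] <-]]]; last first.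
  by apply/is_arndt_rcons.
have [ods|evs] := boolP (odd (size s)); last by left.
right; case/lastP: s ars ods => // s a + ods.
have evs : ~~ odd (size s) by move: ods; rewrite size_rcons.
case/is_arndt_rcons => // ars a0; exists (s, a.-1) => //.
by rewrite /rcons_part /= prednK.
Qed.

(** * Summability by weight *)

Lemma finite_compositions n :
  finite_set [set s | is_composition s /\ (weight s <= n)%N].
Proof.
suff [L inL] : exists L : seq (seq nat),
    forall s, is_composition s -> (weight s <= n)%N -> s \in L.
  by apply: sub_finite_set (finite_seq L) => s [cs ws]; apply: inL.
elim: n => [|n [L inL]].
  by exists [:: [::]] => -[|[|a] s] //=; rewrite /weight /=; lia.
(* The head is at most [n.+1], and being positive it leaves a tail of weight at most [n]. *)
exists ([::] :: [seq a :: s | a <- iota 0 n.+2, s <- L]) => -[|a s]; first by rewrite inE.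
move=> /andP[a0 ps] le; rewrite /weight /= in le; rewrite in_cons; apply/orP; right.
apply/allpairsPdep; exists a, s; split=> //; first by rewrite mem_iota; lia.
by apply: inL => //; rewrite /weight; lia.
Qed.

Lemma fcoef_fpsXn m n : fcoef (fpsX ^+ m) n = (n == m)%:R.
Proof.
elim: m n => [//|m IHm] n; rewrite exprS fcoefM.
case: n => [|n]; first by rewrite big_ord1 mul0r.
rewrite 2!big_ord_recl big1 => [|i _]; last by rewrite mul0r.
by rewrite /= mul0r add0r mul1r addr0 subSS subn0 IHm eqSS.
Qed.

(** The factor x^weight kills degree [n] once the weight exceeds [n], whatever [f] is, and finitely
    many compositions remain. *)
Lemma fps_summable_weight (A : set (seq nat)) (f : seq nat -> fps2) :
  (forall s, A s -> is_composition s) ->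
  fps_summable A (fun s => fpsX ^+ weight s * f s).
Proof.
move=> Acomp n; apply: sub_finite_set (finite_compositions n) => s [As nz].
split; first exact: Acomp.
rewrite leqNgt; apply: contraNN nz => ltn; apply/eqP.
rewrite fcoefM big1 // => i _; rewrite fcoef_fpsXn.
by rewrite ltn_eqF ?mul0r //; apply: leq_ltn_trans ltn; rewrite -ltnS.
Qed.

Lemma weight_rcons_part s a : weight (rcons_part (s, a)) = (weight s + a.+1)%N.
Proof. by rewrite /weight sumn_rcons. Qed.

Lemma weight_rcons_pair s d b :
  weight (rcons_pair (s, (d, b))) = (weight s + (d.+1 + 2 * b.+1))%N.
Proof. by rewrite /weight !sumn_rcons /=; lia. Qed.

Lemma last_part_rcons_part s a : last_part (rcons_part (s, a)) = a.+1.
Proof. by rewrite /last_part last_rcons. Qed.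

Lemma last_part_rcons_pair s d b : last_part (rcons_pair (s, (d, b))) = b.+1.
Proof. by rewrite /last_part last_rcons. Qed.

Lemma fcoef0M (R : comNzRingType) (a b : fps R) :
  fcoef (a * b) 0 = fcoef a 0 * fcoef b 0.
Proof. by rewrite fcoefM big_ord1. Qed.

(** * Generating functions of the blocks *)

Definition geom (c : fps2) : fps2 := fps_sum [set: nat] (fun n => c ^+ n.+1).

Definition even_arndt_gf : fps2 := fps_sum even_arndt (fun s => fpsX ^+ weight s).

Lemma even_arndt_summable : fps_summable even_arndt (fun s => fpsX ^+ weight s).
Proof.
move=> n; have := @fps_summable_weight even_arndt (fun=> 1) _ n.
under eq_set do rewrite mulr1; apply.
by move=> s [[]].
Qed.

(** The pair coded by [(d, b)] has weight [d.+1 + 2 * b.+1] and last part [b.+1], so it contributes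
    [fpsX ^+ d.+1 * (fpsX ^+ 2 * y) ^+ b.+1], with [d] and [b] independent. Keeping [y] arbitrary
    allows both [fpsY] and 1. *)
Lemma fps_sum_arndt_step (y : fps2) :
  fps_sum arndt_step (fun s => fpsX ^+ weight s * y ^+ last_part s) =
  even_arndt_gf * (geom fpsX * geom (fpsX ^+ 2 * y)).
Proof.
have X0 : fcoef fpsX 0 = 0 by [].
have X20 : fcoef (fpsX ^+ 2 * y) 0 = 0 by rewrite fcoef0M fcoef_fpsXn mul0r.
have sX := fps_summable_geom X0; have sX2 := fps_summable_geom X20.
rewrite fps_sum_image; last by move=> p q _ _; apply: rcons_pair_inj.
have := fps_sumM even_arndt_summable (fps_summableM sX sX2).
rewrite (fps_sumM sX sX2); apply: etrans.
apply: eq_fps_sum => -[s [d b]] _ /=.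
rewrite weight_rcons_pair last_part_rcons_pair.
rewrite (exprD _ (weight s)) (exprD _ d.+1) (exprM _ 2).
rewrite [(_ * y) ^+ _]exprMn.
by rewrite !mulrA.
Qed.

Lemma fps_sum_even_arndt (y : fps2) :
  fps_sum even_arndt (fun s => fpsX ^+ weight s * y ^+ last_part s) =
  1 + even_arndt_gf * (geom fpsX * geom (fpsX ^+ 2 * y)).
Proof.
rewrite -fps_sum_arndt_step even_arndtE fps_sumU; first last.
- by move=> s [-> [[t [d b]] _]]; case: t.
- by rewrite -even_arndtE; apply: fps_summable_weight => s [[]].
by rewrite fps_sum_set1 mul1r.
Qed.

Lemma fps_sum_odd_arndt (y : fps2) :
  fps_sum (rcons_part @` (even_arndt `*` setT))
    (fun s => fpsX ^+ weight s * y ^+ last_part s) =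
  even_arndt_gf * geom (fpsX * y).
Proof.
have XY0 : fcoef (fpsX * y) 0 = 0 by rewrite fcoef0M mul0r.
rewrite fps_sum_image; last by move=> p q _ _; apply: rcons_part_inj.
have := fps_sumM even_arndt_summable (fps_summable_geom XY0); apply: etrans.
apply: eq_fps_sum => -[s a] _ /=.
by rewrite weight_rcons_part last_part_rcons_part exprD exprMn mulrA.
Qed.

Lemma arndt_summable :
  fps_summable arndt_compositions (fun s => fpsX ^+ weight s * fpsY ^+ last_part s).
Proof. by apply: fps_summable_weight => s []. Qed.

Lemma fps_sum_arndt :
  fps_sum arndt_compositions (fun s => fpsX ^+ weight s * fpsY ^+ last_part s) =
  1 + even_arndt_gf * (geom fpsX * geom (fpsX ^+ 2 * fpsY) + geom (fpsX * fpsY)).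
Proof.
rewrite arndtE fps_sumU; first last.
(* The two classes are disjoint by parity of length. *)
- by move=> s [[_ evs] [[t a] [[_ evt] _] defs]]; move: evs; rewrite -defs size_rcons /= evt.
- by rewrite -arndtE; exact: arndt_summable.
by rewrite fps_sum_even_arndt fps_sum_odd_arndt mulrDr addrA.
Qed.

(* Setting y = 1 makes the recursion for even lengths an equation for the
   generating function by weight alone. *)
Lemma even_arndt_gfE :
  even_arndt_gf * (1 - fpsX - fpsX ^+ 2) = (1 - fpsX) * (1 - fpsX ^+ 2).
Proof.
have eE : even_arndt_gf = 1 + even_arndt_gf * (geom fpsX * geom (fpsX ^+ 2)).
  rewrite -[in geom (fpsX ^+ 2)](mulr1 (fpsX ^+ 2)) -fps_sum_even_arndt.
  by apply: eq_fps_sum => s _; rewrite expr1n mulr1.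
have g1 : (1 - fpsX) * geom fpsX = fpsX by exact: fps_sum_geom.
have g2 : (1 - fpsX ^+ 2) * geom (fpsX ^+ 2) = fpsX ^+ 2.
  by apply: fps_sum_geom; rewrite fcoef_fpsXn.
move: even_arndt_gf (geom fpsX) (geom (fpsX ^+ 2)) eE g1 g2 => e a b eE g1 g2.
(* With x = [fpsX], this uses 1 - x - x^2 = (1 - x)(1 - x^2) - x * x^2, where the last x and x^2 are
   rewritten by [g1] and [g2]. *)
transitivity (e * ((1 - fpsX) * (1 - fpsX ^+ 2)
                   - (1 - fpsX) * a * ((1 - fpsX ^+ 2) * b))).
  by rewrite g1 g2; ring.
transitivity ((1 - fpsX) * (1 - fpsX ^+ 2) * (e - e * (a * b))); first by ring.
by rewrite {1}eE addrK mulr1.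
Qed.

(** * The closed rational form *)

Lemma arndt_identity (R : comNzRingType) (x y a b c e : R) :
  (1 - x) * a = x -> (1 - x ^+ 2 * y) * b = x ^+ 2 * y ->
  (1 - x * y) * c = x * y ->
  e * (1 - x - x ^+ 2) = (1 - x) * (1 - x ^+ 2) ->
  (1 + e * (a * b + c)) *
    ((1 - x - x ^+ 2) * (1 - x * y) * (1 - x ^+ 2 * y)) =
  1 - x - x ^+ 2 - x ^+ 2 * y + 2%:R * x ^+ 3 * y
    + 2%:R * x ^+ 4 * y - x ^+ 5 * y - x ^+ 4 * y ^+ 2.
Proof.
move=> ga gb gc ge.
(* The regrouping exposes the left sides of [gb], [gc] and [ge]. Rewriting with [ge] then supplies
   the factor [1 - x] that [ga] needs to eliminate [a]. *)
transitivity ((1 - x - x ^+ 2) * (1 - x * y) * (1 - x ^+ 2 * y)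
  + e * (1 - x - x ^+ 2) * (a * ((1 - x ^+ 2 * y) * b) * (1 - x * y)
                            + (1 - x * y) * c * (1 - x ^+ 2 * y))); first by ring.
rewrite ge gb gc.
transitivity ((1 - x - x ^+ 2) * (1 - x * y) * (1 - x ^+ 2 * y)
  + (1 - x ^+ 2) * ((1 - x) * a * (x ^+ 2 * y) * (1 - x * y)
                    + (1 - x) * (x * y) * (1 - x ^+ 2 * y))); first by ring.
by rewrite ga; ring.
Qed.

Lemma unitrM3 (R : comUnitRingType) (a b c : R) :
  a \is a GRing.unit -> b \is a GRing.unit -> c \is a GRing.unit ->
  a * b * c \is a GRing.unit.
Proof. by move=> ua ub uc; rewrite !unitrM ua ub. Qed.

Lemma unit_1sub (c : fps2) : fcoef c 0 = 0 -> 1 - c \is a GRing.unit.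
Proof.
(* A series in x is a unit exactly when its constant coefficient, here 1 in Z[[y]], is one. *)
move=> c0; change (fcoef (1 - c) 0 \is a GRing.unit).
by rewrite [fcoef _ _]/= c0 subr0 unitr1.
Qed.

Theorem theorem3p1 :
  fps2_summable arndt_compositions
    (fun s => fpsX ^+ weight s * fpsY ^+ last_part s) /\
  fps2_sum arndt_compositions
    (fun s => fpsX ^+ weight s * fpsY ^+ last_part s) =
  (1 - fpsX - fpsX ^+ 2 - fpsX ^+ 2 * fpsY + 2%:R * fpsX ^+ 3 * fpsY
     + 2%:R * fpsX ^+ 4 * fpsY - fpsX ^+ 5 * fpsY - fpsX ^+ 4 * fpsY ^+ 2) /
  ((1 - fpsX - fpsX ^+ 2) * (1 - fpsX * fpsY) * (1 - fpsX ^+ 2 * fpsY)).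
Proof.
split; first exact: fps2_summableW arndt_summable.
rewrite (fps2_sumE arndt_summable) fps_sum_arndt.
set D := (X in _ / X); have unitD : D \is a GRing.unit.
  have fX : fcoef (fpsX + fpsX ^+ 2) 0 = 0.
    rewrite -[LHS]/(fcoef fpsX 0 + fcoef (fpsX ^+ 2) 0) (fcoef_fpsXn 2).
    exact: addr0.
  have u1 : 1 - fpsX - fpsX ^+ 2 \is a GRing.unit.
    have -> : 1 - fpsX - fpsX ^+ 2 = 1 - (fpsX + fpsX ^+ 2) by ring.
    exact: unit_1sub fX.
  have u2 : 1 - fpsX * fpsY \is a GRing.unit.
    by apply: unit_1sub; rewrite fcoef0M mul0r.
  have u3 : 1 - fpsX ^+ 2 * fpsY \is a GRing.unit.
    by apply: unit_1sub; rewrite fcoef0M fcoef_fpsXn mul0r.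
  exact: (unitrM3 u1 u2 u3).
apply: (canRL (mulrK unitD)).
have g1 : (1 - fpsX) * geom fpsX = fpsX by exact: fps_sum_geom.
have g2 : (1 - fpsX ^+ 2 * fpsY) * geom (fpsX ^+ 2 * fpsY) = fpsX ^+ 2 * fpsY.
  by apply: fps_sum_geom; rewrite fcoef0M fcoef_fpsXn mul0r.
have g3 : (1 - fpsX * fpsY) * geom (fpsX * fpsY) = fpsX * fpsY.
  by apply: fps_sum_geom; rewrite fcoef0M mul0r.
exact: (arndt_identity g1 g2 g3 even_arndt_gfE).
Qed.
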